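(* Let $M$ be an $N$-function with dual $N$-function $M^*$ such that $L_M\subset L_2\subset L_{M^*}$. Let $f(\omega,u)$ be a Carath\'eodory function on $\Omega\times\mathbb{C}$ whose superposition operator $(fx)(\omega)=f(\omega,x(\omega))$ maps $L_M$ into $L_{M^*}$. Let $S$ be a linear operator defined on $L_{M^*}$ with values in the space of measurable functions on $\Omega$, and let $T:L_M\to L_{M^*}$ be a linear operator with $STx=x$ for all $x\in L_M$. Let $g\in L_M$ and put $\Phi x=Tx-f(x)-Tg$ for $x\in L_M$. Suppose that: (i) there is a real $\sigma$ with $\mathrm{Re}\,\langle Tx,x\rangle\ge\sigma\|x\|_2^2$ for all $x\in L_M$; (ii) there are constants $a,b>0$ and a $\mu$-integrable function $c(\cdot)$ on $\Omega$ with $-\mathrm{Re}\,\big(\overline{u}f(\omega,u)\big)\ge a\,M(b|u|)-c(\omega)$ for all $\omega\in\Omega$, $u\in\mathbb{C}$; (iii) $\phi$ is a positive function such that, for some $R_0>0$, $\mathcal{M}(x)\ge\phi(\|x\|)$ for all $x\in L_M$ with $\|x\|\ge R_0$. If $\sigma\ge 0$ and $r^{-1}\phi(r)\to\infty$ as $r\to\infty$, then the Rothe condition is satisfied for all sufficiently large $R$, i.e. for all sufficiently large $R$ one has $\mathrm{Re}\,\langle\Phi x,x\rangle\ge 0$ for every $x\in L_M$ with $\|x\|=R$.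
   Context: $(\Omega,\mathfrak{A},\mu)$ is a set with a $\sigma$-algebra and a $\sigma$-additive measure $\mu$ that is finite and continuous (every set of positive measure can be divided into two sets of equal measure). An $N$-function is a convex function $M:[0,\infty)\to[0,\infty)$ with $\lim_{u\to0}M(u)/u=0$ and $\lim_{u\to\infty}M(u)/u=\infty$; its dual is $M^*(u)=\sup\{uv-M(v):0\le v<\infty\}$. The modular is $\mathcal{M}(x)=\int_\Omega M(|x(\omega)|)\,d\mu(\omega)$. The Orlicz space $L_M$ is the set of measurable functions $x$ with $\mathcal{M}(x/\lambda)<\infty$ for some $\lambda>0$ (similarly $L_{M^*}$). The norm $\|\cdot\|$ on $L_M$ is the Luxemburg norm $\|x\|=\inf\{\lambda>0:\mathcal{M}(x/\lambda)\le1\}$; $\|\cdot\|_2$ is the $L_2(\Omega,\mu)$-norm. The coupling of $L_{M^*}$ and $L_M$ is $\langle y,x\rangle=\int_\Omega y(\omega)\overline{x(\omega)}\,d\mu(\omega)$. Functions are complex-valued. A Carath\'eodory function $f(\omega,u)$ is measurable in $\omega$ for each $u$ and continuous in $u$ for almost every $\omega$. *)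

(* Defs.v *)
From HB Require Import structures.
From mathcomp Require Import all_boot all_order all_algebra.
From mathcomp Require Import all_classical all_reals all_analysis.
From mathcomp Require Export complex.

Set Implicit Arguments.
Unset Strict Implicit.
Unset Printing Implicit Defensive.

Import Order.TTheory GRing.Theory Num.Theory.
Import numFieldNormedType.Exports.

Local Open Scope classical_set_scope.
Local Open Scope ring_scope.
Local Open Scope complex_scope.

Section NFunction.
Context {R : realType}.

(* M : [0, oo[ -> [0, oo[ is represented by a total function on R of which
   only the values on [0, oo[ are ever used. *)
Definition N_function (M : R -> R) : Prop :=
  [/\ forall u, 0 <= u -> 0 <= M u,
      convex_function (`[0, +oo[%classic : set R) M,
      M u / u @[u --> 0^'+] --> 0
    & M u / u @[u --> +oo] --> +oo].

Definition N_dual (M : R -> R) (u : R) : R :=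
  sup [set u * v - M v | v in `[0, +oo[%classic].

End NFunction.

Section Orlicz.
Context {R : realType} {d : measure_display} {Om : measurableType d}.
Implicit Types (mu : {measure set Om -> \bar R}) (M : R -> R).
Implicit Types (x y : Om -> R[i]).

Definition continuous_measure mu : Prop :=
  forall A, measurable A -> (0 < mu A)%E ->
    exists B, [/\ measurable B, B `<=` A & mu B = mu (A `\` B)].

(* R[i] carries no measurable structure in the libraries; measurability for
   the Borel sets of the plane is measurability of both coordinates. *)
Definition cmeasurable x : Prop :=
  measurable_fun setT (fun w => complex.Re (x w)) /\
  measurable_fun setT (fun w => complex.Im (x w)).

(* Elements of the function spaces below are represented by measurable
   functions, two of them standing for the same element when they are equal
   almost everywhere (see linear_operator). *)

Definition modulus x : Om -> R := fun w => Normc.normc (x w).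

Definition modular mu M x : \bar R := (\int[mu]_w (M (modulus x w))%:E)%E.

Definition scale_down (lambda : R) x : Om -> R[i] :=
  fun w => x w / lambda%:C.

Definition orlicz mu M : set (Om -> R[i]) :=
  [set x | cmeasurable x /\
    exists2 lambda : R, 0 < lambda &
      (modular mu M (scale_down lambda x) < +oo)%E].

(* [inf set0 = 0] in the library; for x in the Orlicz space the set below can
   only be empty when M 0 > 0, a value that convexity on [0, oo[ and the two
   limits alone do not exclude. *)
Definition luxemburg mu M x : R :=
  inf [set lambda : R |
    0 < lambda /\ (modular mu M (scale_down lambda x) <= 1)%E].

Definition L2 mu : set (Om -> R[i]) :=
  [set x | cmeasurable x /\ finite_norm mu 2%:E (modulus x)].

Definition norm2 mu x : R :=
  fine ('N[mu]_2%:E[EFin \o modulus x])%E.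

Definition cintegral mu x : R[i] :=
  Rintegral mu setT (fun w => complex.Re (x w)) +i*
  Rintegral mu setT (fun w => complex.Im (x w)).

Definition coupling mu y x : R[i] := cintegral mu (fun w => y w * (x w)^*).

(* A complex-linear operator between spaces of classes modulo almost
   everywhere equality, given on representatives. *)
Definition linear_operator mu (D E : set (Om -> R[i]))
    (A : (Om -> R[i]) -> (Om -> R[i])) : Prop :=
  [/\ forall x, D x -> E (A x),
      forall x y, D x -> D y -> x = y %[ae mu] -> A x = A y %[ae mu]
    & forall (a : R[i]) x y, D x -> D y ->
        A (fun w => a * x w + y w) = (fun w => a * A x w + A y w) %[ae mu]].

(* R[i]^o gives access to the norm topology of the numFieldType R[i]. *)
Definition caratheodory mu (f : Om -> R[i] -> R[i]) : Prop :=
  (forall u, cmeasurable (f ^~ u)) /\ 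
  {ae mu, forall w, continuous (f w : R[i]^o -> R[i]^o)}.

Definition superposition (f : Om -> R[i] -> R[i]) x : Om -> R[i] :=
  fun w => f w (x w).

Definition rothe_condition mu M (Phi : (Om -> R[i]) -> (Om -> R[i])) (r : R)
    : Prop :=
  forall x, orlicz mu M x -> luxemburg mu M x = r ->
    0 <= complex.Re (coupling mu (Phi x) x).

End Orlicz.

(* Main.v *)
Require Import Defs.
From HB Require Import structures.
From mathcomp Require Import all_boot all_order all_algebra.
From mathcomp Require Import all_classical all_reals all_analysis.
From mathcomp Require Import measurable_realfun ring lra.

Set Implicit Arguments.
Unset Strict Implicit.
Unset Printing Implicit Defensive.

Import Order.TTheory GRing.Theory Num.Theory.
Import numFieldNormedType.Exports.

Local Open Scope classical_set_scope.
Local Open Scope ring_scope.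
Local Open Scope complex_scope.

(** The dissipativity of [f] beats every linear perturbation.  For
    [r = luxemburg mu M x], split [Re <Phi x, x>] into
    [Re <T x, x> - Re <f(x), x> - Re <T g, x>].  The first term is at least
    [sigma * norm2 mu x ^+ 2 >= 0].  Integrating the pointwise lower bound on
    [- Re (u^* * f w u)] shows that the second contributes at least
    [a * modular (b x) - \int c >= a * phi (b r) - \int c], because the
    Luxemburg norm is positively homogeneous ([luxemburg_scale_down]).  By
    Young's inequality integrated over the space ([integral_modulusM_le]), the
    third is at most [K * r] in absolute value, where [K] depends only on [T g]
    ([normr_Re_coupling_le]).  Since [phi s / s] tends to infinity,
    [a * phi (b r)] exceeds [K * r + \int c] as soon as [r] is large.

    Splitting the coupling requires the integrands to be integrable one by one;
    this too is Young's inequality ([integrable_Re_conjM]).  The modular of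
    [b x] is then finite because it is dominated by integrable terms
    ([coercive_coupling_ge]). *)

(** * N-functions and their duals *)

Section NFunctionTheory.
Context {R : realType}.
Implicit Types (M F : R -> R).

(** The sublevel sets of such an [F] in the half-line are intervals.  The
    hypothesis is quasiconvexity, which covers convex and monotone functions at
    once; it replaces continuity, since an N-function may jump at 0. *)
Lemma quasiconvex_measurable F :
  (forall x y z, 0 <= x -> x <= z -> z <= y -> F z <= Num.max (F x) (F y)) ->
  measurable_fun (`[0, +oo[%classic : set R) F.
Proof.
move=> qF mD; apply: (measurability _ (RGenInftyO.measurableE R)) => //.
move=> _ [_ [t ->] <-]; apply: is_interval_measurable.
move=> u v [/= u0 Fu] [/= v0 Fv] z /andP[uz zv].
move: u0 Fu v0 Fv; rewrite !in_itv/= !andbT => u0 Fu v0 Fv.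
split; first exact: le_trans u0 uz.
by rewrite (le_lt_trans (qF _ _ _ u0 uz zv))// gt_max Fu.
Qed.

Lemma N_function_quasiconvex M x y z : N_function M ->
  0 <= x -> x <= z -> z <= y -> M z <= Num.max (M x) (M y).
Proof.
move=> [_ cM _ _] x0 xz zy.
have [xy|yx] := ltP x y; last first.
  have -> : z = x by apply/le_anti; rewrite xz (le_trans zy).
  by rewrite le_max lexx.
have yx0 : 0 < y - x by rewrite subr_gt0.
have t0 : 0 <= (y - z) / (y - x) by rewrite divr_ge0 ?subr_ge0// ltW.
have t1 : (y - z) / (y - x) <= 1 by rewrite ler_pdivrMr// mul1r lerB.
have xD : x \in (`[0, +oo[%classic : set R) by rewrite inE/= in_itv/= x0.
have yD : y \in (`[0, +oo[%classic : set R).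
  by rewrite inE/= in_itv/= (le_trans x0 (ltW xy)).
have := cM (Itv01 t0 t1) x y xD yD.
rewrite -[leLHS]/(M ((y - z) / (y - x) * x + (1 - (y - z) / (y - x)) * y)).
rewrite convRE /unstable.onem/=.
have -> : (y - z) / (y - x) * x + (1 - (y - z) / (y - x)) * y = z.
  by field; rewrite gt_eqF.
move=> /le_trans; apply.
have : M x <= Num.max (M x) (M y) by rewrite le_max lexx.
have : M y <= Num.max (M x) (M y) by rewrite le_max lexx orbT.
move: (Num.max _ _) ((y - z) / _) t0 t1 => m t t0 t1 My Mx.
have : 0 <= 1 - t by rewrite subr_ge0.
nra.
Qed.

(** Superlinearity of [M] makes [u * v - M v] negative for large [v], and
    [M >= 0] bounds it by [u * v] elsewhere. *)
Lemma has_ubound_N_dual M u : N_function M -> 0 <= u ->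
  has_ubound [set u * v - M v | v in `[0, +oo[%classic].
Proof.
move=> [M0 _ _ My] u0.
move/cvgryPge : My => /(_ u) [V [_ HV]].
exists (u * Num.max V 0) => z [v + <-{z}]; rewrite /= in_itv/= andbT => v0.
have [Vv|vV] := ltP (Num.max V 0) v.
  have vgt0 : 0 < v by rewrite (le_lt_trans _ Vv)// le_max lexx orbT.
  have : u <= M v / v by apply: HV; rewrite (le_lt_trans _ Vv)// le_max lexx.
  rewrite ler_pdivlMr// => uM.
  by rewrite (@le_trans _ _ 0) ?subr_le0// mulr_ge0// le_max lexx orbT.
rewrite (@le_trans _ _ (u * v)) ?ler_wpM2l//.
by rewrite gerBl M0.
Qed.

Lemma young M u v : N_function M -> 0 <= u -> 0 <= v ->
  u * v <= M v + N_dual M u.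
Proof.
move=> NM u0 v0; rewrite addrC -lerBlDr.
apply: ub_le_sup; first exact: has_ubound_N_dual.
by exists v => //=; rewrite in_itv/= v0.
Qed.

(** The value [- M 0] at [v = 0] may be negative, hence the passage to the limit
    [v -> 0^'+]. *)
Lemma N_dual_ge0 M u : N_function M -> 0 <= u -> 0 <= N_dual M u.
Proof.
move=> NM u0; rewrite leNgt; apply/negP => D0.
have [_ _ M0 _] := NM.
move/cvgrPdist_lt : M0 => /(_ (- N_dual M u)).
rewrite oppr_gt0 => /(_ D0) M0.
have : \forall v \near (0 : R)^'+, False.
  near=> v.
  have v0 : 0 < v by near: v; exact: nbhs_right_gt.
  have v1 : v < 1 by near: v; apply: nbhs_right_lt; exact: ltr01.
  have : `|0 - M v / v| < - N_dual M u by near: v.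
  rewrite sub0r normrN ltNge => /negP; apply.
  rewrite (le_trans _ (ler_norm _))// ler_pdivlMr//.
  have := young NM u0 (ltW v0).
  have : 0 <= u * v by rewrite mulr_ge0// ltW.
  by nra.
by move=> /filter_ex [].
Unshelve. all: by end_near. Qed.

Lemma N_dual_le M u1 u2 : N_function M -> 0 <= u1 -> u1 <= u2 ->
  N_dual M u1 <= N_dual M u2.
Proof.
move=> NM u10 u12; apply: ge_sup.
  by exists (u1 * 0 - M 0); exists 0 => //=; rewrite in_itv/= lexx.
move=> z [v + <-{z}]; rewrite /= in_itv/= andbT => v0.
by rewrite lerBlDl (le_trans _ (young _ _ _)) ?ler_wpM2r// (le_trans u10).
Qed.

Lemma measurable_N_function M : N_function M ->
  measurable_fun (`[0, +oo[%classic : set R) M.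
Proof.
move=> NM; apply: quasiconvex_measurable => x y z.
exact: N_function_quasiconvex.
Qed.

Lemma measurable_N_dual M : N_function M ->
  measurable_fun (`[0, +oo[%classic : set R) (N_dual M).
Proof.
move=> NM; apply: quasiconvex_measurable => x y z x0 xz zy.
by rewrite le_max (N_dual_le NM _ zy) ?orbT// (le_trans x0).
Qed.

End NFunctionTheory.

(** * Moduli and modulars of complex functions *)

Section OrliczTheory.
Context {R : realType} {d : measure_display} {Om : measurableType d}.
Implicit Types (M F : R -> R) (x y : Om -> R[i]).

Lemma modulus_ge0 x w : 0 <= modulus x w.
Proof. by rewrite /modulus; case: (x w) => p q; exact: sqrtr_ge0. Qed.

Lemma modulus_scale_down l x w : 0 < l ->
  modulus (scale_down l x) w = modulus x w / l.
Proof.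
move=> l0; rewrite /modulus /scale_down Normc.normcM Normc.normcV; congr (_ / _).
by rewrite /= expr0n addr0 sqrtr_sqr gtr0_norm.
Qed.

Lemma scale_down_comp k l x : 0 < k -> 0 < l ->
  scale_down l (scale_down k x) = scale_down (k * l) x.
Proof.
move=> k0 l0; apply/funext => w; rewrite /scale_down -mulrA; congr (_ * _).
by rewrite rmorphM/= invfM.
Qed.

Lemma scale_down_cmeasurable l x : cmeasurable x -> cmeasurable (scale_down l x).
Proof.
have E w : scale_down l x w =
    (complex.Re (x w) / l) +i* (complex.Im (x w) / l).
  rewrite /scale_down -fmorphV/=; case: (x w) => p q /=.
  by apply/eqP; rewrite eq_complex/= !mulr0 subr0 add0r !eqxx.
move=> [mRe mIm]; split.
  under eq_fun do rewrite E/=.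
  exact: measurable_funM.
under eq_fun do rewrite E/=.
exact: measurable_funM.
Qed.

Lemma measurable_modulus x : cmeasurable x -> measurable_fun setT (modulus x).
Proof.
move=> [mRe mIm].
have -> : modulus x = Num.sqrt \o
    (fun w => complex.Re (x w) ^+ 2 + complex.Im (x w) ^+ 2).
  by apply/funext => w; rewrite /modulus/=; case: (x w).
apply: (@measurableT_comp _ _ _ _ _ _ (@Num.sqrt R)).
  by apply: continuous_measurable_fun => t; exact: sqrt_continuous.
by apply: measurable_funD; exact: measurable_funX.
Qed.

Lemma measurable_comp_modulus F x :
  measurable_fun (`[0, +oo[%classic : set R) F -> cmeasurable x ->
  measurable_fun setT (fun w => F (modulus x w)).
Proof.
move=> mF mx; apply: (measurable_comp _ _ mF (measurable_modulus mx)).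
  exact: measurable_itv.
by move=> _ [w _ <-] /=; rewrite in_itv/= modulus_ge0.
Qed.

Lemma normr_Re_conjM (u v : R[i]) :
  `|complex.Re (u * v^*)| <= Normc.normc u * Normc.normc v.
Proof.
have -> : Normc.normc v = Normc.normc v^* by case: v => p q /=; rewrite sqrrN.
rewrite -Normc.normcM; case: (u * _) => p q /=.
by rewrite -sqrtr_sqr ler_wsqrtr// lerDl sqr_ge0.
Qed.

Lemma measurable_Re_conjM x y : cmeasurable x -> cmeasurable y ->
  measurable_fun setT (fun w => complex.Re (y w * (x w)^*)).
Proof.
move=> [xRe xIm] [yRe yIm].
have E w : complex.Re (y w * (x w)^*) =
    complex.Re (y w) * complex.Re (x w) + complex.Im (y w) * complex.Im (x w).
  by case: (y w) (x w) => [p q] [s t] /=; rewrite mulrN opprK.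
under eq_fun do rewrite E.
by apply: measurable_funD; exact: measurable_funM.
Qed.

Section Measure.
Variable mu : {measure set Om -> \bar R}.

(** The infimum over the empty set is 0, so that a positive norm guarantees
    an admissible scaling factor. *)
Lemma luxemburg_set_nonempty M x : 0 < luxemburg mu M x ->
  [set l : R | 0 < l /\ (modular mu M (scale_down l x) <= 1)%E] !=set0.
Proof.
move=> x0; apply/set0P/negP => /eqP E.
by move: x0; rewrite /luxemburg E inf0 ltxx.
Qed.

Lemma luxemburg_scale_down M k x : 0 < k -> 0 < luxemburg mu M x ->
  luxemburg mu M (scale_down k x) = luxemburg mu M x / k.
Proof.
move=> k0 /luxemburg_set_nonempty nS.
have lb z : has_lbound
    [set l : R | 0 < l /\ (modular mu M (scale_down l z) <= 1)%E].
  by exists 0 => l [/ltW].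
apply/le_anti/andP; split.
  rewrite ler_pdivlMr//; apply: lb_le_inf => // l [l0 Ml].
  rewrite -ler_pdivlMr//; apply: ge_inf; first exact: lb.
  split; first by rewrite divr_gt0.
  by rewrite scale_down_comp ?divr_gt0// mulrC divfK// gt_eqF.
apply: lb_le_inf => [|l [l0 Ml]].
  case: nS => l [l0 Ml]; exists (l / k); split; first by rewrite divr_gt0.
  by rewrite scale_down_comp ?divr_gt0// mulrC divfK// gt_eqF.
rewrite ler_pdivrMr// mulrC; apply: ge_inf; first exact: lb.
by split; [rewrite mulr_gt0|rewrite -scale_down_comp].
Qed.

Lemma orlicz_scale_down M k x : 0 < k -> orlicz mu M x ->
  orlicz mu M (scale_down k x).
Proof.
move=> k0 [mx [l l0 Ml]]; split; first exact: scale_down_cmeasurable.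
exists (l / k); first by rewrite divr_gt0.
by rewrite scale_down_comp ?divr_gt0// mulrC divfK// gt_eqF.
Qed.

(** * Duality between the Orlicz spaces *)

(** Young's inequality applied to [|y| / k] and [|x| / l]. *)
Lemma integral_modulusM_le M x y k l : N_function M ->
  cmeasurable x -> cmeasurable y -> 0 < k -> 0 < l ->
  (\int[mu]_w (modulus y w * modulus x w)%:E <=
   (k * l)%:E * (modular mu M (scale_down l x) +
                 modular mu (N_dual M) (scale_down k y)))%E.
Proof.
move=> NM mx my k0 l0; have [M0 _ _ _] := NM.
have mX : measurable_fun setT (fun w => (M (modulus (scale_down l x) w))%:E).
  apply/measurable_EFinP/measurable_comp_modulus.
    exact: measurable_N_function.
  exact: scale_down_cmeasurable.
have mY : measurable_fun setT
    (fun w => (N_dual M (modulus (scale_down k y) w))%:E).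
  apply/measurable_EFinP/measurable_comp_modulus.
    exact: measurable_N_dual.
  exact: scale_down_cmeasurable.
have X0 w : (0 <= (M (modulus (scale_down l x) w))%:E)%E.
  by rewrite lee_fin M0 ?modulus_ge0.
have Y0 w : (0 <= (N_dual M (modulus (scale_down k y) w))%:E)%E.
  by rewrite lee_fin N_dual_ge0 ?modulus_ge0.
rewrite /modular -ge0_integralD//.
have kl0 : 0 <= k * l by rewrite mulr_ge0 ?ltW.
rewrite -ge0_integralZl//; last 2 first.
- exact: emeasurable_funD.
- by move=> w _; rewrite adde_ge0.
apply: ge0_le_integral => //.
- by move=> w _; rewrite lee_fin mulr_ge0// modulus_ge0.
- by apply/measurable_EFinP/measurable_funM; exact: measurable_modulus.
- by apply: emeasurable_funM => //; exact: emeasurable_funD.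
move=> w _; rewrite -EFinD -EFinM lee_fin.
rewrite -ler_pdivrMl ?mulr_gt0//.
apply: le_trans (young NM (modulus_ge0 (scale_down k y) w)
                          (modulus_ge0 (scale_down l x) w)).
rewrite !modulus_scale_down// le_eqVlt; apply/orP; left; apply/eqP.
by field; rewrite !gt_eqF.
Qed.

Lemma integrable_modulusM M x y : N_function M ->
  orlicz mu M x -> orlicz mu (N_dual M) y ->
  mu.-integrable setT (EFin \o (fun w => modulus y w * modulus x w)).
Proof.
move=> NM [mx [l l0 Ml]] [my [k k0 Mk]]; apply/integrableP; split.
  by apply/measurable_EFinP/measurable_funM; exact: measurable_modulus.
under eq_integral do rewrite /= ger0_norm ?mulr_ge0 ?modulus_ge0//.
apply: le_lt_trans (integral_modulusM_le NM mx my k0 l0) _.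
rewrite lte_mul_pinfty//; first by rewrite lee_fin mulr_ge0// ltW.
exact: lte_add_pinfty.
Qed.

Lemma integrable_Re_conjM M x y : N_function M ->
  orlicz mu M x -> orlicz mu (N_dual M) y ->
  mu.-integrable setT (EFin \o (fun w => complex.Re (y w * (x w)^*))).
Proof.
move=> NM Mx My; apply: le_integrable (integrable_modulusM NM Mx My) => //.
  by apply/measurable_EFinP/measurable_Re_conjM; [case: Mx|case: My].
move=> w _; rewrite /= lee_fin (le_trans (normr_Re_conjM _ _))//.
exact: ler_norm.
Qed.

Lemma Re_couplingB3 M x y1 y2 y3 : N_function M -> orlicz mu M x ->
  orlicz mu (N_dual M) y1 -> orlicz mu (N_dual M) y2 ->
  orlicz mu (N_dual M) y3 ->
  complex.Re (coupling mu (fun w => y1 w - y2 w - y3 w) x) =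
  complex.Re (coupling mu y1 x) - complex.Re (coupling mu y2 x) -
  complex.Re (coupling mu y3 x).
Proof.
move=> NM Mx My1 My2 My3; rewrite /coupling /cintegral/=.
rewrite -RintegralB//; [|exact: (integrable_Re_conjM NM)..].
rewrite -RintegralB//; last 2 first.
- exact: (integrableB measurableT (integrable_Re_conjM NM Mx My1)
                                   (integrable_Re_conjM NM Mx My2)).
- exact: (integrable_Re_conjM NM).
by apply: eq_Rintegral => w _; rewrite !mulrBl !raddfB.
Qed.

(** Fixing a scaling factor [k] for [y] leaves a bound linear in the factor [l]
    for [x], and [l] may be chosen below twice the norm of [x]. *)
Lemma normr_Re_coupling_le M y : N_function M -> orlicz mu (N_dual M) y ->
  exists2 K : R, 0 <= K & forall x, orlicz mu M x -> 0 < luxemburg mu M x ->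
    `|complex.Re (coupling mu y x)| <= K * luxemburg mu M x.
Proof.
move=> NM My; have [my [k k0 Mk]] := My.
set B := modular mu (N_dual M) (scale_down k y) in Mk.
have B0 : (0 <= B)%E.
  by apply: integral_ge0 => w _; rewrite lee_fin N_dual_ge0 ?modulus_ge0.
have Bfin : B \is a fin_num by rewrite ge0_fin_numE.
exists (2 * k * (1 + fine B)).
  by rewrite !mulr_ge0 ?addr_ge0 ?fine_ge0// ltW.
move=> x Mx x0; have [mx _] := Mx.
have [l [l0 Ml] l2] : exists2 l, 0 < l /\
    (modular mu M (scale_down l x) <= 1)%E & l < 2 * luxemburg mu M x.
  apply: inf_lt; first exact: luxemburg_set_nonempty.
  by rewrite -/(luxemburg mu M x) ltr_pMl// ltr1n.
have iyx := integrable_modulusM NM Mx My.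
rewrite /coupling /cintegral/=.
apply: le_trans (le_normr_Rintegral _ _) _ => //.
  exact: (integrable_Re_conjM NM).
apply: (@le_trans _ _ (Rintegral mu setT (fun w => modulus y w * modulus x w))).
  apply: le_Rintegral => //.
    apply: (@le_integrable _ _ _ _ _ measurableT _ _ _ _ iyx) => //.
      apply/measurable_EFinP/measurableT_comp => //.
      exact: measurable_Re_conjM.
    move=> w _; rewrite /= lee_fin normr_id (le_trans (normr_Re_conjM _ _))//.
    exact: ler_norm.
  by move=> w _; exact: normr_Re_conjM.
apply: (@le_trans _ _ (k * l * (1 + fine B))); last first.
  have : 0 <= k * (1 + fine B) by rewrite mulr_ge0 ?addr_ge0 ?fine_ge0// ltW.
  move: (fine B) l2 => beta l2 beta0; nra.
rewrite -lee_fin /Rintegral fineK; last first.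
  exact: (integrable_fin_num _ iyx).
apply: le_trans (integral_modulusM_le NM mx my k0 l0) _.
rewrite [leRHS]EFinM EFinD fineK// lee_wpmul2l//.
  by rewrite lee_fin mulr_ge0// ltW.
exact: leeD.
Qed.

End Measure.
End OrliczTheory.

(** * Coercivity *)

(** The integrand [a * M (b * |x|)] lies between 0 and the integrable function
    [c - Re (x^* * y)]; in particular the modular of [b * x] is finite. *)
Lemma coercive_coupling_ge (R : realType) (d : measure_display)
    (Om : measurableType d) (mu : {measure set Om -> \bar R})
    (M : R -> R) (a b : R) (c : Om -> R) (x y : Om -> R[i]) :
  N_function M -> orlicz mu M x -> orlicz mu (N_dual M) y ->
  0 < a -> 0 < b -> mu.-integrable setT (EFin \o c) ->
  (forall w, a * M (b * Normc.normc (x w)) - c w <=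
             - complex.Re ((x w)^* * y w)) ->
  (a%:E * modular mu M (scale_down b^-1 x) <=
   (Rintegral mu setT c - complex.Re (coupling mu y x))%:E)%E.
Proof.
move=> NM Mx My a0 b0 ic yx; have [M0 _ _ _] := NM.
have iyx := integrable_Re_conjM NM Mx My.
have bx w : modulus (scale_down b^-1 x) w = b * Normc.normc (x w).
  by rewrite modulus_scale_down ?invr_gt0// invrK mulrC.
have mM : measurable_fun setT (fun w => M (modulus (scale_down b^-1 x) w)).
  apply: measurable_comp_modulus; first exact: measurable_N_function.
  by apply: scale_down_cmeasurable; case: Mx.
rewrite /coupling /cintegral/= -RintegralB// /Rintegral fineK; last first.
  exact: (integrable_fin_num _ (integrableB measurableT ic iyx)).
rewrite /modular -ge0_integralZl//; last 3 first.
- exact/measurable_EFinP.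
- by move=> w _; rewrite lee_fin M0 ?modulus_ge0.
- by rewrite lee_fin ltW.
apply: ge0_le_integral => //.
- by move=> w _; rewrite mule_ge0 ?lee_fin ?M0 ?modulus_ge0// ltW.
- by apply: emeasurable_funM => //; exact/measurable_EFinP.
- by have /integrableP[] := integrableB measurableT ic iyx.
move=> w _; rewrite -EFinM lee_fin bx.
by have := yx w; rewrite [_^* * _]mulrC lerBlDl.
Qed.

Theorem mainTheorem5 (R : realType) (d : measure_display)
    (Om : measurableType d) (mu : {finite_measure set Om -> \bar R})
    (mu_continuous : continuous_measure mu)
    (M : R -> R) (M_N : N_function M)
    (LM_L2 : orlicz mu M `<=` L2 mu)
    (L2_LMdual : L2 mu `<=` orlicz mu (N_dual M))
    (f : Om -> R[i] -> R[i]) (f_car : caratheodory mu f)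
    (f_maps : forall x, orlicz mu M x ->
       orlicz mu (N_dual M) (superposition f x))
    (S T : (Om -> R[i]) -> (Om -> R[i]))
    (S_lin : linear_operator mu (orlicz mu (N_dual M)) cmeasurable S)
    (T_lin : linear_operator mu (orlicz mu M) (orlicz mu (N_dual M)) T)
    (ST_id : forall x, orlicz mu M x -> S (T x) = x %[ae mu])
    (g : Om -> R[i]) (g_LM : orlicz mu M g)
    (sigma : R)
    (T_below : forall x, orlicz mu M x ->
       sigma * norm2 mu x ^+ 2 <= complex.Re (coupling mu (T x) x))
    (a b : R) (c : Om -> R) (a_gt0 : 0 < a) (b_gt0 : 0 < b)
    (c_int : mu.-integrable setT (EFin \o c))
    (f_below : forall (w : Om) (u : R[i]),
       a * M (b * Normc.normc u) - c w <= - complex.Re (u^* * f w u))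
    (phi : R -> R) (phi_gt0 : forall r, 0 < r -> 0 < phi r)
    (R0 : R) (R0_gt0 : 0 < R0)
    (modular_below : forall x, orlicz mu M x -> R0 <= luxemburg mu M x ->
       ((phi (luxemburg mu M x))%:E <= modular mu M x)%E)
    (sigma_ge0 : 0 <= sigma)
    (phi_superlinear : r^-1 * phi r @[r --> +oo] --> +oo) :
  \forall r \near +oo,
    rothe_condition mu M
      (fun x w => T x w - superposition f x w - T g w) r.
Proof.
have MTg : orlicz mu (N_dual M) (T g) by case: T_lin => TM _ _; exact: TM.
have [K K0 HK] := normr_Re_coupling_le M_N MTg.
set C := Rintegral mu setT c.
have ab0 : 0 < a * b by rewrite mulr_gt0.
(* With s = b r, this slope gives a * phi s >= (K + |C|) r. *)
move/cvgryPge : phi_superlinear => /(_ ((K + `|C|) / (a * b))) [P [_ HP]].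
near=> r.
have r0 : 0 < r by near: r; exact: nbhs_pinfty_gt.
have r1 : 1 <= r by near: r; exact: nbhs_pinfty_ge.
have rR0 : R0 <= b * r.
  rewrite mulrC -ler_pdivrMr//; near: r; exact/nbhs_pinfty_ge/num_real.
have rP : P < b * r.
  rewrite mulrC -ltr_pdivrMr//; near: r; exact/nbhs_pinfty_gt/num_real.
move=> x Mx xr.
have MTx : orlicz mu (N_dual M) (T x) by case: T_lin => TM _ _; exact: TM.
have Mfx := f_maps _ Mx.
have xb : luxemburg mu M (scale_down b^-1 x) = b * r.
  by rewrite luxemburg_scale_down ?xr ?invr_gt0// invrK mulrC.
have Mbx : orlicz mu M (scale_down b^-1 x).
  by apply: orlicz_scale_down => //; rewrite invr_gt0.
have := modular_below _ Mbx; rewrite xb => /(_ rR0) phiM.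
have fx : a * phi (b * r) <= C - complex.Re (coupling mu (superposition f x) x).
  rewrite -lee_fin EFinM.
  apply: le_trans (coercive_coupling_ge M_N Mx Mfx a_gt0 b_gt0 c_int
                     (fun w => f_below w (x w))).
  by rewrite lee_wpmul2l// lee_fin ltW.
have Tx : 0 <= complex.Re (coupling mu (T x) x).
  by apply: le_trans (T_below _ Mx); rewrite mulr_ge0// sqr_ge0.
have Tgx : complex.Re (coupling mu (T g) x) <= K * r.
  by rewrite -xr (le_trans (ler_norm _))// HK// xr.
have phir : (K + `|C|) * r <= a * phi (b * r).
  have := HP _ rP; rewrite ler_pdivrMr// -mulrA ler_pdivlMl ?mulr_gt0// => Hb.
  by rewrite -(ler_pM2l b_gt0); lra.
have Cr : C <= `|C| * r by rewrite (le_trans (ler_norm _))// ler_peMr.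
rewrite (Re_couplingB3 M_N Mx MTx Mfx MTg).
by lra.
Unshelve. all: by end_near. Qed.
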